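(* Let $V\xrightarrow{R}\mathfrak{g}$ be an rRB Leibniz algebra and let $(W\xrightarrow{S}\mathfrak{h},l,r)$ be a representation of it. Then the vector space $\mathfrak{h}$ carries a representation of the induced Leibniz algebra $V_R$ with left and right $V_R$-actions $l_\triangleright:V_R\otimes\mathfrak{h}\to\mathfrak{h}$ and $r_\triangleleft:\mathfrak{h}\otimes V_R\to\mathfrak{h}$ given by $$l_\triangleright(v,h)=l_\mathfrak{h}(R(v),h)-S(l(v,h)),\qquad r_\triangleleft(h,v)=r_\mathfrak{h}(h,R(v))-S(r(h,v)),\quad\text{for }v\in V_R,\ h\in\mathfrak{h}.$$
   Context: All vector spaces and linear maps are over a field $\mathbf{k}$ of characteristic $0$. Leibniz algebra: a vector space $\mathfrak{g}$ with a linear map $[~,~]_\mathfrak{g}:\mathfrak{g}\otimes\mathfrak{g}\to\mathfrak{g}$ satisfying $[x,[y,z]_\mathfrak{g}]_\mathfrak{g}=[[x,y]_\mathfrak{g},z]_\mathfrak{g}+[y,[x,z]_\mathfrak{g}]_\mathfrak{g}$. A representation of $\mathfrak{g}$ is a vector space $V$ with linear maps $l_V:\mathfrak{g}\otimes V\to V$, $r_V:V\otimes\mathfrak{g}\to V$ such that $l_V(x,l_V(y,v))=l_V([x,y]_\mathfrak{g},v)+l_V(y,l_V(x,v))$; $l_V(x,r_V(v,y))=r_V(l_V(x,v),y)+r_V(v,[x,y]_\mathfrak{g})$; $r_V(v,[x,y]_\mathfrak{g})=r_V(r_V(v,x),y)+l_V(x,r_V(v,y))$. An rRB Leibniz algebra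 $V\xrightarrow{R}\mathfrak{g}$ consists of a Leibniz algebra $\mathfrak{g}$, a representation $(V,l_V,r_V)$ of it, and a relative Rota-Baxter operator, i.e. a linear map $R:V\to\mathfrak{g}$ with $[R(v),R(v')]_\mathfrak{g}=R(l_V(R(v),v')+r_V(v,R(v')))$ for $v,v'\in V$. The induced Leibniz algebra $V_R$ is the vector space $V$ with the Leibniz bracket $[v,v']_R=l_V(R(v),v')+r_V(v,R(v'))$. A representation of $V\xrightarrow{R}\mathfrak{g}$ is a triple $(W\xrightarrow{S}\mathfrak{h},l,r)$ where $W$ and $\mathfrak{h}$ are representations of the Leibniz algebra $\mathfrak{g}$ (actions $l_W,r_W$ and $l_\mathfrak{h},r_\mathfrak{h}$), $S:W\to\mathfrak{h}$ is a linear map (a 2-term chain complex), and $l:V\otimes\mathfrak{h}\to W$, $r:\mathfrak{h}\otimes V\to W$ are linear maps such that for all $x\in\mathfrak{g}$, $v\in V$, $h\in\mathfrak{h}$, $w\in W$: $l_W(x,l(v,h))=l(l_V(x,v),h)+l(v,l_\mathfrak{h}(x,h))$; $l(v,l_\mathfrak{h}(x,h))=l(r_V(v,x),h)+l_W(x,l(v,h))$; $l(v,r_\mathfrak{h}(h,x))=r_W(l(v,h),x)+r(h,r_V(v,x))$; $l_W(x,r(h,v))=r(l_\mathfrak{h}(x,h),v)+r(h,l_V(x,v))$; $r(h,l_V(x,v))=r(r_\mathfrak{h}(h,x),v)+l_W(x,r(h,v))$; $r(h,r_V(v,x))=r_W(r(h,v),x)+l(v,r_\mathfrak{h}(h,x))$;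 $l_\mathfrak{h}(R(v),S(w))=S(l_W(R(v),w)+l(v,S(w)))$; $r_\mathfrak{h}(S(w),R(v))=S(r(S(w),v)+r_W(w,R(v)))$. *)

(* Defs.v *)
From HB Require Import structures.
From mathcomp Require Import all_boot all_algebra.
From mathcomp Require Import sesquilinear.

Set Implicit Arguments.
Unset Strict Implicit.
Unset Printing Implicit Defensive.

Import GRing.Theory.
Local Open Scope ring_scope.

(* Linear maps out of a tensor product A (x) B are encoded as bilinear maps
   {bilinear A -> B -> C}. Vector spaces are not assumed finite-dimensional. *)

HB.mixin Record Lmodule_isLeibniz (k : fieldType) g of GRing.Lmodule k g := {
  lbracket : g -> g -> g;
  lbracket_bilinear : bilinear_for *:%R *:%R lbracket;
  lbracket_leibniz : forall x y z : g,
    lbracket x (lbracket y z) =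
    lbracket (lbracket x y) z + lbracket y (lbracket x z)
}.

#[short(type="leibnizAlgType")]
HB.structure Definition LeibnizAlgebra (k : fieldType) :=
  { g of Lmodule_isLeibniz k g & GRing.Lmodule k g }.

HB.instance Definition _ (k : fieldType) (g : leibnizAlgType k) :=
  bilinear_isBilinear.Build k g g g *:%R *:%R (@lbracket k g)
    lbracket_bilinear.

Record leibnizRep (k : fieldType) (g : leibnizAlgType k) (V : lmodType k) :=
  LeibnizRep {
    lact : {bilinear g -> V -> V};
    ract : {bilinear V -> g -> V};
    rep_lact_lact : forall (x y : g) (v : V),
      lact x (lact y v) = lact (lbracket x y) v + lact y (lact x v);
    rep_lact_ract : forall (x y : g) (v : V),
      lact x (ract v y) = ract (lact x v) y + ract v (lbracket x y);
    rep_ract_bracket : forall (x y : g) (v : V),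
      ract v (lbracket x y) = ract (ract v x) y + lact x (ract v y)
  }.

(* An rRB Leibniz algebra V -> g is given by g, rho and R : relRotaBaxter rho. *)
Record relRotaBaxter (k : fieldType) (g : leibnizAlgType k) (V : lmodType k)
    (rho : leibnizRep g V) := RelRotaBaxter {
  rrb_op :> {linear V -> g};
  rrb_eq : forall v v' : V,
    lbracket (rrb_op v) (rrb_op v') =
    rrb_op (lact rho (rrb_op v) v' + ract rho v (rrb_op v'))
}.

(* V_R: an alias of V, so that its bracket is found from the type. *)
Definition induced (k : fieldType) (g : leibnizAlgType k) (V : lmodType k)
  (rho : leibnizRep g V) (R : relRotaBaxter rho) : Type := V.

Section Induced.
Variables (k : fieldType) (g : leibnizAlgType k) (V : lmodType k).
Variables (rho : leibnizRep g V) (R : relRotaBaxter rho).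

HB.instance Definition _ := GRing.Lmodule.on (induced R).

Definition induced_bracket (v v' : induced R) : induced R :=
  lact rho (R v) v' + ract rho v (R v').

Fact induced_bracket_bilinear : bilinear_for *:%R *:%R induced_bracket.
Proof.
split=> [v' a u w|v a u w] /=; rewrite /induced_bracket.
  by rewrite linearP !linearPl scalerDr addrACA.
by rewrite [R (_ + _)]linearP !linearPr scalerDr addrACA.
Qed.

Fact induced_bracket_leibniz (x y z : induced R) :
  induced_bracket x (induced_bracket y z) =
  induced_bracket (induced_bracket x y) z
  + induced_bracket y (induced_bracket x z).
Proof.
rewrite /induced_bracket -!rrb_eq !linearDr !linearDl /=.
rewrite rep_lact_lact rep_lact_ract (rep_ract_bracket rho (R y) (R z)).
by rewrite [LHS](AC (2*2*2) (1*(3*5)*(2*6*4))).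
Qed.

HB.instance Definition _ :=
  Lmodule_isLeibniz.Build k (induced R)
    induced_bracket_bilinear induced_bracket_leibniz.

End Induced.

(* A representation (W -> h, l, r) of V -> g on the given vector spaces W, h. *)
Record rrbRep (k : fieldType) (g : leibnizAlgType k) (V : lmodType k)
    (rho : leibnizRep g V) (R : relRotaBaxter rho) (W h : lmodType k) :=
  RrbRep {
    rrbW : leibnizRep g W;
    rrbh : leibnizRep g h;
    rrbS : {linear W -> h};
    rrbl : {bilinear V -> h -> W};
    rrbr : {bilinear h -> V -> W};
    rrbRep_ll : forall (x : g) (v : V) (u : h),
      lact rrbW x (rrbl v u) = rrbl (lact rho x v) u + rrbl v (lact rrbh x u);
    rrbRep_lr : forall (x : g) (v : V) (u : h),
      rrbl v (lact rrbh x u) = rrbl (ract rho v x) u + lact rrbW x (rrbl v u);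
    rrbRep_rl : forall (x : g) (v : V) (u : h),
      rrbl v (ract rrbh u x) = ract rrbW (rrbl v u) x + rrbr u (ract rho v x);
    rrbRep_Lr : forall (x : g) (v : V) (u : h),
      lact rrbW x (rrbr u v) = rrbr (lact rrbh x u) v + rrbr u (lact rho x v);
    rrbRep_rL : forall (x : g) (v : V) (u : h),
      rrbr u (lact rho x v) = rrbr (ract rrbh u x) v + lact rrbW x (rrbr u v);
    rrbRep_rr : forall (x : g) (v : V) (u : h),
      rrbr u (ract rho v x) = ract rrbW (rrbr u v) x + rrbl v (ract rrbh u x);
    rrbRep_Sl : forall (v : V) (w : W),
      lact rrbh (R v) (rrbS w) = rrbS (lact rrbW (R v) w + rrbl v (rrbS w));
    rrbRep_Sr : forall (v : V) (w : W),
      ract rrbh (rrbS w) (R v) = rrbS (rrbr (rrbS w) v + ract rrbW w (R v))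
  }.

(* Main.v *)
Require Import Defs.
From HB Require Import structures.
From mathcomp Require Import all_boot all_algebra.
From mathcomp Require Import sesquilinear.
Import GRing.Theory.
Local Open Scope ring_scope.

(** The map S intertwines the actions of R v on W with the new actions of v on
    h (lemmas [tri_left_S] and [tri_right_S]). Expanding a double action
    therefore produces only a double action of g on h and images under S of
    terms of degree one in l or r, and the latter match by the six
    compatibility conditions between l, r and the actions of g. *)

Section TriangleAction.
Context {k : fieldType} {g : leibnizAlgType k} {V : lmodType k}.
Context {rho : leibnizRep g V} {R : relRotaBaxter rho} {W h : lmodType k}.
Variable M : rrbRep R W h.

Definition tri_left (v : induced R) (u : h) : h :=
  lact (rrbh M) (R v) u - rrbS M (rrbl M v u).

Definition tri_right (u : h) (v : induced R) : h :=
  ract (rrbh M) u (R v) - rrbS M (rrbr M u v).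

Lemma tri_left_bilinear : bilinear_for *:%R *:%R tri_left.
Proof.
split=> [u a v w|v a u w] /=; rewrite /tri_left.
  by rewrite [R (_ + _)]linearP !linearPl linearP opprD scalerBr addrACA.
by rewrite !linearPr linearP opprD scalerBr addrACA.
Qed.

Lemma tri_right_bilinear : bilinear_for *:%R *:%R tri_right.
Proof.
split=> [v a u w|u a v w] /=; rewrite /tri_right.
  by rewrite !linearPl linearP opprD scalerBr addrACA.
by rewrite [R (_ + _)]linearP !linearPr linearP opprD scalerBr addrACA.
Qed.

HB.instance Definition _ :=
  bilinear_isBilinear.Build k (induced R) h h *:%R *:%R tri_left
    tri_left_bilinear.

HB.instance Definition _ :=
  bilinear_isBilinear.Build k h (induced R) h *:%R *:%R tri_right
    tri_right_bilinear.

(** By [rrbRep_Sl], the term subtracted in [tri_left] is exactly the summand that keeps [S] from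
    intertwining the actions of [R v]; [rrbRep_Sr] does the same for [tri_right]. *)
Lemma tri_left_S (v : induced R) (w : W) :
  tri_left v (rrbS M w) = rrbS M (lact (rrbW M) (R v) w).
Proof. by rewrite /tri_left rrbRep_Sl linearD addrK. Qed.

Lemma tri_right_S (w : W) (v : induced R) :
  tri_right (rrbS M w) v = rrbS M (ract (rrbW M) w (R v)).
Proof. by rewrite /tri_right rrbRep_Sr linearD addrC addKr. Qed.

Lemma induced_bracketE (x y : induced R) :
  lbracket x y = lact rho (R x) y + ract rho x (R y) :> V.
Proof. by []. Qed.

(** This is the Rota-Baxter identity. Through it the uncorrected actions, pulled back along [R],
    already satisfy the axioms, so only images under [S] remain to be compared. *)
Lemma rrb_op_bracket (x y : induced R) :
  R (lbracket x y) = lbracket (R x) (R y).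
Proof. by rewrite rrb_eq. Qed.

Lemma tri_left_left (x y : induced R) (u : h) :
  tri_left x (tri_left y u) =
  tri_left (lbracket x y) u + tri_left y (tri_left x u).
Proof.
(* Only inner actions are unfolded: the outer ones stay bilinear maps, to be split and then absorbed
   by [tri_left_S]. *)
rewrite [tri_left y u in LHS]/tri_left [tri_left x u in RHS]/tri_left.
rewrite !linearBr /= !tri_left_S /tri_left rrb_op_bracket induced_bracketE.
rewrite rep_lact_lact rrbRep_ll rrbRep_lr linearDl !(linearD (rrbS M)) !opprD.
(* Each of the three terms on the left has split in two: 1, 5, 3 form the action of the bracket and
   2, 6, 4 the swapped double action. *)
by rewrite [LHS](AC (2*2*2) ((1*(5*3))*(2*6*4))).
Qed.

Lemma tri_left_right (x y : induced R) (u : h) :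
  tri_left x (tri_right u y) =
  tri_right (tri_left x u) y + tri_right u (lbracket x y).
Proof.
rewrite [tri_right u y in LHS]/tri_right [tri_left x u in RHS]/tri_left.
rewrite linearBr linearBl /= tri_left_S tri_right_S /tri_left /tri_right.
rewrite rrb_op_bracket induced_bracketE.
(* [rrbRep_rl] treats the correction of the outer action, [rrbRep_Lr] that of the inner one. *)
rewrite rep_lact_ract rrbRep_rl rrbRep_Lr linearDr !(linearD (rrbS M)) !opprD.
by rewrite [LHS](AC (2*2*2) ((1*5*3)*(2*(6*4)))).
Qed.

Lemma tri_right_bracket (x y : induced R) (u : h) :
  tri_right u (lbracket x y) =
  tri_right (tri_right u x) y + tri_left x (tri_right u y).
Proof.
rewrite [tri_right u x in RHS]/tri_right [tri_right u y in RHS]/tri_right.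
rewrite linearBr linearBl /= tri_left_S tri_right_S /tri_left /tri_right.
rewrite rrb_op_bracket induced_bracketE.
(* The left side is a single action; its correction splits along the two summands of the [V_R]
   bracket, treated by [rrbRep_rL] and [rrbRep_rr] respectively. *)
rewrite rep_ract_bracket linearDr rrbRep_rL rrbRep_rr !(linearD (rrbS M)) !opprD.
by rewrite [LHS](AC (2*(2*2)) ((1*3*5)*(2*6*4))).
Qed.

Definition tri_rep : leibnizRep (induced R) h :=
  @LeibnizRep k (induced R) h tri_left tri_right
    tri_left_left tri_left_right tri_right_bracket.

End TriangleAction.

Theorem proposition4p8 (k : fieldType) (char_k : [pchar k] =i pred0)
    (g : leibnizAlgType k) (V : lmodType k) (rho : leibnizRep g V)
    (R : relRotaBaxter rho) (W h : lmodType k) (M : rrbRep R W h) :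
  exists tau : leibnizRep (induced R) h,
    (forall (v : induced R) (u : h),
       lact tau v u = lact (rrbh M) (R v) u - rrbS M (rrbl M v u)) /\
    (forall (v : induced R) (u : h),
       ract tau u v = ract (rrbh M) u (R v) - rrbS M (rrbr M u v)).
Proof. by exists (tri_rep M). Qed.
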